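(* Let $\mathbb K$ be a complete separable non-Archimedean valued field with nontrivial valuation. For all $\lambda,\mu\in\mathbb K$, the operator $T_{\lambda,\mu}=\lambda I+\mu B$ on $c_0(\mathbb Z)$ is not supercyclic, where $I$ is the identity and $B$ is the bilateral unweighted backward shift.
   Context: A non-Archimedean valued field is a commutative field $\mathbb K$ with a map $|\cdot|:\mathbb K\to[0,+\infty)$ such that $|\lambda|=0$ iff $\lambda=0$, $|\lambda\mu|=|\lambda||\mu|$, and $|\lambda+\mu|\le\max\{|\lambda|,|\mu|\}$; the valuation is always assumed nontrivial. $c_0(\mathbb Z)=\{(x_n)_{n\in\mathbb Z}: x_n\in\mathbb K,\ |x_{\pm n}|\to 0 \text{ as } n\to+\infty\}$ with norm $\|\mathbf x\|=\sup_n|x_n|$, assumed to be a separable Banach space (equivalently, $\mathbb K$ is complete and separable). $B$ is the continuous linear operator with $B(\mathbf e_n)=\mathbf e_{n-1}$ for all $n\in\mathbb Z$, where $\mathbf e_n$ has $n$-th coordinate $1$ and other coordinates $0$; i.e. $(B\mathbf x)_n=x_{n+1}$. A continuous linear operator $T$ on $X$ is supercyclic if there exists $\mathbf x\in X$ such that $\{\alpha T^n(\mathbf x): n\in\mathbb Z,\ n\ge 0,\ \alpha\in\mathbb K\}$ is dense in $X$. *)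

(* Defs.v *)
From HB Require Import structures.
From mathcomp Require Import all_boot all_order all_algebra.
From mathcomp Require Import all_classical all_reals all_analysis.

Set Implicit Arguments.
Unset Strict Implicit.
Unset Printing Implicit Defensive.

Import Order.TTheory GRing.Theory Num.Theory.
Import numFieldTopology.Exports numFieldNormedType.Exports.

Local Open Scope classical_set_scope.
Local Open Scope ring_scope.

Record nonarch_valuation (R : realType) (K : fieldType) := NonarchValuation {
  vabs :> K -> R ;
  vabs_ge0 : forall x, 0 <= vabs x ;
  vabs_eq0 : forall x, vabs x = 0 <-> x = 0 ;
  vabsM : forall x y, vabs (x * y) = vabs x * vabs y ;
  vabsD : forall x y, vabs (x + y) <= Num.max (vabs x) (vabs y) }.

Definition nontrivial_valuation (R : realType) (K : fieldType)
    (v : nonarch_valuation R K) :=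
  exists x : K, x != 0 /\ v x != 1.

(* an alias of K that carries the metric |x - y| *)
Definition valued (R : realType) (K : fieldType) (v : nonarch_valuation R K) :
  Type := K.

Section valued_metric.
Context (R : realType) (K : fieldType) (v : nonarch_valuation R K).
Implicit Types x y z : K.

Lemma vabs0 : v 0 = 0.
Proof. exact/vabs_eq0. Qed.

Lemma vabs1 : v 1 = 1.
Proof.
have v1 : v 1 != 0 by apply/eqP => /vabs_eq0 /eqP; rewrite oner_eq0.
by apply: (mulfI v1); rewrite -vabsM !mulr1.
Qed.

Lemma vabsN x : v (- x) = v x.
Proof.
suff vN1 : v (- 1) = 1 by rewrite -mulN1r vabsM vN1 mul1r.
have /eqP : v (- 1) * v (- 1) = 1 by rewrite -vabsM mulrNN mulr1 vabs1.
by rewrite -expr2 sqrp_eq1 ?vabs_ge0// => /eqP.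
Qed.

Lemma vabsD_le x y : v (x + y) <= v x + v y.
Proof. by rewrite (le_trans (vabsD _ _ _))// ge_max lerDl lerDr !vabs_ge0. Qed.

Let dist x y : R := v (x - y).

Let distxx x : dist x x = 0.
Proof. by rewrite /dist subrr vabs0. Qed.

Let dist_pos x y : dist x y = 0 -> x = y.
Proof. by move/vabs_eq0/eqP; rewrite subr_eq0 => /eqP. Qed.

Let dist_sym x y : dist x y = dist y x.
Proof. by rewrite /dist -opprB vabsN. Qed.

Let dist_triangle y x z : dist x z <= dist x y + dist y z.
Proof. by rewrite /dist -(subrKA y) vabsD_le. Qed.

HB.instance Definition _ := GRing.Field.on (valued v).
HB.instance Definition _ := isMetric.Build R (valued v)
  distxx dist_pos dist_sym dist_triangle.

Lemma mdist_valuedE (x y : valued v) : mdist x y = v (x - y).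
Proof. by []. Qed.

End valued_metric.

(* the axiom of the library's completeType *)
Definition complete_space (T : uniformType) :=
  forall F : set_system T, ProperFilter F -> cauchy F -> exists l : T, F --> l.

Definition separable_space (T : topologicalType) :=
  exists2 D : set T, countable D & dense D.

Section c0_def.
Context (R : realType) (K : fieldType) (v : nonarch_valuation R K).

(* K^o is K seen as a module over itself *)
Definition c0_set : set (int -> K^o) :=
  [set x | (fun n : nat => v (x n%:Z)) @ \oo --> (0 : R) /\
           (fun n : nat => v (x (- n%:Z))) @ \oo --> (0 : R)].

Definition c0_pred : {pred int -> K^o} := fun x => x \in c0_set.

Record c0 := C0 { c0_seq :> int -> K^o ; c0_seqP : c0_seq \in c0_pred }.

Lemma vabs_cvg0D (a b : nat -> K) :
  (v (a n) : R) @[n --> \oo] --> 0 -> (v (b n) : R) @[n --> \oo] --> 0 ->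
  (v (a n + b n) : R) @[n --> \oo] --> 0.
Proof.
move=> a0 b0.
apply: (@squeeze_cvgr _ _ _ _ (fun=> 0) (fun n => v (a n) + v (b n))).
- by near=> n; rewrite vabs_ge0 vabsD_le.
- exact: cvg_cst.
- by rewrite -[X in _ --> X](addr0 (0 : R)); exact: cvgD.
Unshelve. all: by end_near. Qed.

Lemma vabs_cvg0Z (k : K) (a : nat -> K) :
  (v (a n) : R) @[n --> \oo] --> 0 -> (v (k * a n) : R) @[n --> \oo] --> 0.
Proof.
move=> a0; have : (v k * v (a n) : R) @[n --> \oo] --> v k * 0.
  by apply: cvgM => //; exact: cvg_cst.
by rewrite mulr0; under eq_fun do rewrite -vabsM.
Qed.

Lemma c0_submod_closed : submod_closed c0_pred.
Proof.
split=> [|k x y].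
  by rewrite inE; split; under eq_fun do rewrite vabs0; exact: cvg_cst.
rewrite !inE => -[xp xm] [yp ym]; split.
- apply: (@vabs_cvg0D (fun n => k * x n%:Z) (fun n => y n%:Z)) => //.
  exact: vabs_cvg0Z.
- apply: (@vabs_cvg0D (fun n => k * x (- n%:Z)) (fun n => y (- n%:Z))) => //.
  exact: vabs_cvg0Z.
Qed.

HB.instance Definition _ := GRing.isSubmodClosed.Build K (int -> K^o) c0_pred
  c0_submod_closed.
HB.instance Definition _ := [isSub for c0_seq].
HB.instance Definition _ := [Choice of c0 by <:].
HB.instance Definition _ := [SubChoice_isSubLmodule of c0 by <:].

Lemma c0_bounded (x : c0) : has_ubound (range (fun n => v (x n))).
Proof.
have bnd (a : nat -> K) : (v (a n) : R) @[n --> \oo] --> 0 ->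
    exists M, forall n, v (a n) <= M.
  move=> a0; have : cvgn (fun n => v (a n) : R) by apply/cvg_ex; exists 0.
  move=> /cvg_seq_bounded/pinfty_ex_gt0[M _ aM]; exists M => n.
  by have /= := aM n Logic.I; rewrite ger0_norm ?vabs_ge0.
have := c0_seqP x; rewrite inE => -[/(bnd (fun n => x n%:Z))[M xM]].
move=> /(bnd (fun n => x (- n%:Z)))[N xN].
exists (Num.max M N) => _ [n _ <-]; rewrite le_max.
by case: (intP n) => [|m|m]; rewrite ?(xM 0%N) ?xM ?xN ?orbT.
Qed.

Definition c0_norm (x : c0) : R := sup (range (fun n => v (x n))).

Lemma vabs_le_c0_norm (x : c0) n : v (x n) <= c0_norm x.
Proof. by apply: ub_le_sup; [exact: c0_bounded | exists n]. Qed.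

Lemma c0_norm_le (x : c0) (M : R) : (forall n, v (x n) <= M) -> c0_norm x <= M.
Proof. by move=> xM; apply: ge_sup; [exists (v (x 0)), 0 | move=> _ [n _ <-]]. Qed.

Lemma c0_ext (x y : c0) : (forall n, x n = y n) -> x = y.
Proof. by move=> xy; apply: val_inj; apply/funext. Qed.

Let dist (x y : c0) : R := c0_norm (x - y).

Let distxx x : dist x x = 0.
Proof.
apply/eqP; rewrite /dist subrr eq_le c0_norm_le => [/=|n]; last by rewrite vabs0.
by rewrite -(vabs0 v) (vabs_le_c0_norm 0 0).
Qed.

Let dist_pos x y : dist x y = 0 -> x = y.
Proof.
move=> xy0; apply: c0_ext => n; apply/eqP; rewrite -subr_eq0; apply/eqP.
apply/(vabs_eq0 v)/eqP; rewrite eq_le vabs_ge0 andbT -xy0.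
exact: (vabs_le_c0_norm (x - y) n).
Qed.

Let dist_sym x y : dist x y = dist y x.
Proof.
rewrite /dist -opprB /c0_norm.
by congr sup; apply: eq_imagel => n _ /=; rewrite vabsN.
Qed.

Let dist_triangle y x z : dist x z <= dist x y + dist y z.
Proof.
apply: c0_norm_le => n.
have -> : (x - z) n = (x - y) n + (y - z) n by rewrite /= addrA subrK.
rewrite (le_trans (vabsD_le v _ _))// lerD//.
- exact: (vabs_le_c0_norm (x - y) n).
- exact: (vabs_le_c0_norm (y - z) n).
Qed.

HB.instance Definition _ := isMetric.Build R c0
  distxx dist_pos dist_sym dist_triangle.

End c0_def.

Section c0_operators.
Context (R : realType) (K : fieldType) (v : nonarch_valuation R K).
Local Notation X := (c0 v).

Lemma c0_delta_subproof (m : int) :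
  (fun n : int => (n == m)%:R : K^o) \in c0_pred v.
Proof.
rewrite inE; split; apply: cvg_near_cst.
- exists (`|m|%N.+1) => // n /= mn; case: eqP => [nm|_]; last by rewrite vabs0.
  by move: mn; rewrite -nm /= ltnn.
- exists (`|m|%N.+1) => // n /= mn; case: eqP => [nm|_]; last by rewrite vabs0.
  by move: mn; rewrite -nm abszN /= ltnn.
Qed.

Definition c0_delta (m : int) : X := C0 (c0_delta_subproof m).

Lemma bshift_subproof (x : X) : (fun n : int => x (n + 1)) \in c0_pred v.
Proof.
have := c0_seqP x; rewrite !inE => -[xp xm]; split.
- have := xp; rewrite -(cvg_shiftS (fun n : nat => v (x n%:Z))).
  by under eq_fun do rewrite -addn1 PoszD.
- rewrite -(cvg_shiftS (fun n : nat => v (x (- n%:Z + 1)))).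
  by under eq_fun do rewrite -addn1 PoszD opprD subrK.
Qed.

Definition bshift (x : X) : X := C0 (bshift_subproof x).

Lemma bshift_is_linear : linear bshift.
Proof. by move=> k x y; apply: c0_ext. Qed.

HB.instance Definition _ := GRing.isLinear.Build K X X _ bshift bshift_is_linear.

Lemma bshift_delta m : bshift (c0_delta m) = c0_delta (m - 1).
Proof.
by apply: c0_ext => n /=; rewrite [in RHS]eq_sym subr_eq [in RHS]eq_sym.
Qed.

Definition shift_pencil (lambda mu : K) : {linear X -> X} :=
  lambda \*: idfun \+ mu \*: bshift.

Lemma shift_pencilE lambda mu (x : X) :
  shift_pencil lambda mu x = lambda *: x + mu *: bshift x.
Proof. by []. Qed.

Lemma mdist_c0E (x y : X) : mdist x y = c0_norm (x - y).
Proof. by []. Qed.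

Lemma shift_pencil_continuous lambda mu : continuous (shift_pencil lambda mu).
Proof.
move=> x; apply/(metricType_numDomainType.cvgrPdist_lt (FF := nbhs_filter x)) => e e0.
pose M := v lambda + v mu + 1.
have M0 : 0 < M by rewrite ltr_wpDl// addr_ge0 ?vabs_ge0.
near=> y; rewrite mdist_c0E -linearB.
have bnd (z : X) : c0_norm (shift_pencil lambda mu z) <= M * c0_norm z.
  apply: c0_norm_le => n.
  have -> : shift_pencil lambda mu z n = lambda * z n + mu * z (n + 1) by [].
  rewrite (le_trans (vabsD_le v _ _))// !vabsM /M 2!mulrDl mul1r -[leLHS]addr0.
  rewrite !lerD ?ler_wpM2l ?vabs_ge0 ?vabs_le_c0_norm//.
  exact: le_trans (vabs_ge0 v _) (vabs_le_c0_norm z 0).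
rewrite (le_lt_trans (bnd _))// mulrC -ltr_pdivlMr// -mdist_c0E.
near: y; apply: metricType_numDomainType.cvgr_dist_lt; first exact: cvg_id.
by rewrite divr_gt0.
Unshelve. all: by end_near. Qed.

(* T ranges over all linear maps, not only the continuous ones; the operators of
   interest are continuous by shift_pencil_continuous. *)
Definition supercyclic (T : {linear X -> X}) :=
  exists x : X, dense [set y | exists (a : K) (n : nat), y = a *: iter n T x].

End c0_operators.

(* Main.v *)
Require Import Defs.
From mathcomp Require Import all_boot all_order all_algebra.
From mathcomp Require Import all_classical all_reals all_analysis.
From mathcomp Require Import zify.

(** Only finitely many coordinates of a nonzero [z] in [c_0(Z)] reach the
    absolute value [r = ||z||]; let [m] be the first such index and [M] the last
    one.  Dividing by a scalar of absolute value [r] and reducing modulo the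
    maximal ideal turns [z] into a nonzero Laurent polynomial over the residue
    field, with lowest and highest exponents [m] and [M].  The operator
    [T = lambda I + mu B] becomes, up to a scalar, multiplication by a binomial
    or a monomial, so its effect on [m] and [M] is known exactly:
    - if [|lambda| <> |mu|], then [T] translates [m] and [M] by the same amount
      ([edges_pencil_lt], [edges_pencil_gt]);
    - if [|lambda| = |mu| <> 0], then [T] moves [m] to [m - 1] and keeps [M]
      ([edges_pencil_eq]).

    The triple [(r, m, M)] is shared by all vectors at distance less than [r]
    ([edges_perturb]), so if the projective orbit of [x] were dense it would
    contain vectors with any prescribed [m] and [M].  In the first case this
    is impossible because the width [M - m] is constant along the projective
    orbit, whereas [e_0] has width 0 and [e_0 + e_1] has width 1.  In the second
    case every nonzero vector in the range of [T] has positive width, so a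
    vector [a T^n x] close to [e_0] or to [e_1] has [n = 0]; then [x] itself
    would have first index 0 and first index 1.  The same conclusion
    holds for [lambda = mu = 0], where the range of [T] is zero. *)

Set Implicit Arguments.
Unset Strict Implicit.
Unset Printing Implicit Defensive.

Import Order.TTheory GRing.Theory Num.Theory.
Import numFieldTopology.Exports numFieldNormedType.Exports.

Local Open Scope classical_set_scope.
Local Open Scope ring_scope.

(** * First and last indices where the norm is attained *)

Section Edges.
Context (R : realType) (K : fieldType) (v : nonarch_valuation R K).
Implicit Types (z w : int -> K) (r : R) (m M n : int).

Lemma vabsD_ltr (a b : K) : v a < v b -> v (a + b) = v b.
Proof.
move=> ab; apply/eqP; rewrite eq_le; apply/andP; split.
  by rewrite (le_trans (vabsD _ _ _))// ge_max lexx andbT ltW.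
have := vabsD v (a + b) (- a); rewrite addrAC subrr add0r vabsN le_max.
by case/orP => // /le_lt_trans /(_ ab); rewrite ltxx.
Qed.

Lemma vabsD_ltl (a b : K) : v b < v a -> v (a + b) = v a.
Proof. by rewrite addrC; exact: vabsD_ltr. Qed.

Lemma vabsD_lt (a b : K) r : v a < r -> v b < r -> v (a + b) < r.
Proof. by move=> ar br; rewrite (le_lt_trans (vabsD _ _ _))// gt_max ar. Qed.

Lemma vabsD_bound (a b : K) r : v a <= r -> v b <= r -> v (a + b) <= r.
Proof. by move=> ar br; rewrite (le_trans (vabsD _ _ _))// ge_max ar. Qed.

Lemma vabs_gt0 (a : K) : a != 0 -> 0 < v a.
Proof.
move=> a0; rewrite lt_def vabs_ge0 andbT.
by apply: contra a0 => /eqP/vabs_eq0 ->.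
Qed.

(** The number [r] is the sup norm of [z], attained for the first time at [m]
    and for the last time at [M]: these are the lowest and highest exponents of
    the Laurent polynomial obtained by reducing [z] at level [r]. *)
Record edges z r m M : Prop := Edges {
  edges_gt0 : 0 < r ;
  edges_le : forall n, v (z n) <= r ;
  edges_first : v (z m) = r ;
  edges_last : v (z M) = r ;
  edges_before : forall n, n < m -> v (z n) < r ;
  edges_after : forall n, M < n -> v (z n) < r }.

Lemma edges_uniq z r m M r' m' M' :
  edges z r m M -> edges z r' m' M' -> [/\ r = r', m = m' & M = M'].
Proof.
move=> [_ le fi la be af] [_ le' fi' la' be' af'].
have rr' : r = r'.
  by apply/eqP; rewrite eq_le -{1}fi le' -fi' le.
rewrite -rr' in fi' la' be' af' *; split => //.
- by case: (ltgtP m m') => [/be'|/be|//]; rewrite ?fi ?fi' ltxx.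
- by case: (ltgtP M M') => [/af|/af'|//]; rewrite ?la ?la' ltxx.
Qed.

Lemma edges_leq z r m M : edges z r m M -> m <= M.
Proof. by case=> _ _ _ la be _; rewrite leNgt; apply/negP => /be; rewrite la ltxx. Qed.

(** Where [v (z n)] reaches [r], a perturbation below [r] leaves it unchanged by
    the ultrametric inequality; elsewhere it cannot lift it to [r]. *)
Lemma edges_perturb z w r m M :
  edges z r m M -> (forall n, v (z n - w n) < r) -> edges w r m M.
Proof.
move=> [r0 le fi la be af] zw.
have wE n : w n = z n + - (z n - w n) by rewrite opprB addrC subrK.
have zwN n : v (- (z n - w n)) < r by rewrite vabsN.
split=> // [n|||n /be zn|n /af zn].
- by rewrite wE vabsD_bound// ltW.
- by rewrite wE vabsD_ltl fi.
- by rewrite wE vabsD_ltl la.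
- by rewrite wE vabsD_lt.
- by rewrite wE vabsD_lt.
Qed.

Lemma edges_scale z r m M (a : K) :
  a != 0 -> edges z r m M -> edges (fun n => a * z n) (v a * r) m M.
Proof.
move=> /vabs_gt0 a0 [r0 le fi la be af].
split=> [|n|||n /be|n /af]; rewrite ?vabsM ?fi ?la //.
- exact: mulr_gt0.
- by rewrite ler_pM2l.
- by rewrite ltr_pM2l.
- by rewrite ltr_pM2l.
Qed.

(** * Effect of the pencil on these indices *)

Section Pencil.
Context (lambda mu : K).

Definition pencil_seq z : int -> K := fun n => lambda * z n + mu * z (n + 1).

(** The term [mu B] dominates at both ends, and [B] is a translation. *)
Lemma edges_pencil_lt z r m M : v lambda < v mu ->
  edges z r m M -> edges (pencil_seq z) (v mu * r) (m - 1) (M - 1).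
Proof.
move=> lm [r0 le fi la be af].
have mu0 : 0 < v mu := le_lt_trans (vabs_ge0 v _) lm.
have small n : v (lambda * z n) < v mu * r.
  rewrite vabsM (le_lt_trans (ler_wpM2l (vabs_ge0 v _) (le n)))//.
  by rewrite ltr_pM2r.
split=> [|n|||n nm|n nM].
- exact: mulr_gt0.
- by apply: vabsD_bound; [exact: ltW | rewrite vabsM ler_pM2l].
- have zm : v (mu * z m) = v mu * r by rewrite vabsM fi.
  by rewrite /pencil_seq subrK vabsD_ltr zm.
- have zM : v (mu * z M) = v mu * r by rewrite vabsM la.
  by rewrite /pencil_seq subrK vabsD_ltr zM.
- by apply: vabsD_lt => //; rewrite vabsM ltr_pM2l// be// -ltrBrDr.
- by apply: vabsD_lt => //; rewrite vabsM ltr_pM2l// af// -ltrBlDr.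
Qed.

(** The term [lambda I] dominates at both ends. *)
Lemma edges_pencil_gt z r m M : v mu < v lambda ->
  edges z r m M -> edges (pencil_seq z) (v lambda * r) m M.
Proof.
move=> lm [r0 le fi la be af].
have la0 : 0 < v lambda := le_lt_trans (vabs_ge0 v _) lm.
have small n : v (mu * z n) < v lambda * r.
  rewrite vabsM (le_lt_trans (ler_wpM2l (vabs_ge0 v _) (le n)))//.
  by rewrite ltr_pM2r.
split=> [|n|||n nm|n nM].
- exact: mulr_gt0.
- by apply: vabsD_bound; [rewrite vabsM ler_pM2l | exact: ltW].
- have zm : v (lambda * z m) = v lambda * r by rewrite vabsM fi.
  by rewrite /pencil_seq vabsD_ltl zm.
- have zM : v (lambda * z M) = v lambda * r by rewrite vabsM la.
  by rewrite /pencil_seq vabsD_ltl zM.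
- by apply: vabsD_lt => //; rewrite vabsM ltr_pM2l// be.
- by apply: vabsD_lt => //; rewrite vabsM ltr_pM2l// af.
Qed.

(** At [M] only [z M] is large, at [m - 1] only [z m] is: no cancellation occurs
    at the two ends, while cancellation in between is harmless. *)
Lemma edges_pencil_eq z r m M : v lambda = v mu -> 0 < v mu ->
  edges z r m M -> edges (pencil_seq z) (v mu * r) (m - 1) M.
Proof.
move=> lm mu0 [r0 le fi la be af].
have lle n : v (lambda * z n) <= v mu * r by rewrite vabsM lm ler_pM2l.
have mle n : v (mu * z n) <= v mu * r by rewrite vabsM ler_pM2l.
have llt n : v (z n) < r -> v (lambda * z n) < v mu * r.
  by rewrite vabsM lm ltr_pM2l.
have mlt n : v (z n) < r -> v (mu * z n) < v mu * r by rewrite vabsM ltr_pM2l.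
split=> [|n|||n nm|n nM].
- exact: mulr_gt0.
- exact: vabsD_bound.
- have zm : v (mu * z m) = v mu * r by rewrite vabsM fi.
  by rewrite /pencil_seq subrK vabsD_ltr zm// llt// be// ltrBlDr ltrDl.
- have zM : v (lambda * z M) = v mu * r by rewrite vabsM la lm.
  by rewrite /pencil_seq vabsD_ltl zM// mlt// af// ltrDl.
- by apply: vabsD_lt; [apply/llt/be; lia | apply/mlt/be; lia].
- by apply: vabsD_lt; [apply/llt/af; lia | apply/mlt/af; lia].
Qed.

End Pencil.

(** * Vectors of c_0 and projective orbits *)

Lemma c0_small (x : c0 v) r : 0 < r ->
  exists N : nat, forall n, (N <= `|n|)%N -> v (x n) < r.
Proof.
move=> r0; have := c0_seqP x; rewrite inE => -[xp xm].
have [A _ hA] := cvgr_lt _ xp _ r0.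
have [B _ hB] := cvgr_lt _ xm _ r0.
exists (maxn A B) => n; rewrite geq_max => /andP[An Bn].
have [n0|n0] := leP 0 n.
- by have := hA _ An; rewrite /= gez0_abs.
- by have := hB _ Bn; rewrite /= lez0_abs ?opprK// ltW.
Qed.

Lemma edges_neq0 (x : c0 v) r m M : edges x r m M -> x != 0.
Proof.
move=> xe; apply: contraTneq (edges_gt0 xe) => x0.
by rewrite -(edges_first xe) x0 vabs0 ltxx.
Qed.

(** Outside a finite window all values are below a fixed nonzero one, so the
    supremum is a maximum over the window, and so are the two extremal indices
    where it is attained. *)
Lemma edges_exist (x : c0 v) : x != 0 -> exists r m M, edges x r m M.
Proof.
move=> x0; have [k /vabs_gt0 xk0] : exists k, x k != 0.
  apply: contrapT => nx; move/eqP: x0; apply; apply: c0_ext => k.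
  by apply: contrapT => /eqP xk; apply: nx; exists k.
have [N xN] := c0_small x xk0.
(* The window [-N, N] is indexed by an ordinal type of size [2 N + 1]. *)
pose idx (i : 'I_(N.*2.+1)) : int := i%:Z - N%:Z.
have idxP n : (`|n| <= N)%N -> exists i, idx i = n.
  move=> nN; have lt : (`|(n + N%:Z)%R| < N.*2.+1)%N by lia.
  by exists (Ordinal lt); rewrite /idx /=; lia.
have kN : (`|k| < N)%N by rewrite ltnNge; apply/negP => /xN; rewrite ltxx.
have [i0 i0k] := idxP k (ltnW kN).
have [j _ jmax] := @arg_maxP _ _ _ i0 xpredT (fun i => v (x (idx i))) isT.
set r := v (x (idx j)) in jmax.
have kr : v (x k) <= r by rewrite -i0k; exact: jmax.
have out n : (N < `|n|)%N -> v (x n) < r.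
  by move=> nN; apply: lt_le_trans kr; exact/xN/ltnW.
pose P i := v (x (idx i)) == r.
have jP : P j by rewrite /P.
have [a /eqP ar amin] := arg_minnP (fun i : 'I_(N.*2.+1) => i : nat) jP.
have [b /eqP br bmax] := arg_maxnP (fun i : 'I_(N.*2.+1) => i : nat) jP.
have le n : v (x n) <= r.
  have [/idxP[i <-]|/out/ltW//] := leqP `|n| N; exact: jmax.
exists r, (idx a), (idx b); split => // [|n na|n nb].
- exact: lt_le_trans kr.
- rewrite lt_neqAle le andbT; apply/negP => nr.
  have [/idxP[i iE]|/out] := leqP `|n| N; last by rewrite (eqP nr) ltxx.
  by move: nr na; rewrite -iE => /(amin i); rewrite /idx; lia.
- rewrite lt_neqAle le andbT; apply/negP => nr.
  have [/idxP[i iE]|/out] := leqP `|n| N; last by rewrite (eqP nr) ltxx.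
  by move: nr nb; rewrite -iE => /(bmax i); rewrite /idx; lia.
Qed.

Lemma edges_delta k : edges (c0_delta v k) 1 k k.
Proof.
split=> //= [n|||n nk|n nk].
- by case: eqP; rewrite ?vabs0 ?vabs1.
- by rewrite eqxx vabs1.
- by rewrite eqxx vabs1.
- by rewrite lt_eqF// vabs0.
- by rewrite gt_eqF// vabs0.
Qed.

Lemma edges_deltaD k : edges (c0_delta v k + c0_delta v (k + 1)) 1 k (k + 1).
Proof.
have E n : (c0_delta v k + c0_delta v (k + 1)) n =
    (n == k)%:R + (n == k + 1)%:R by [].
split=> // [n|||n nk|n nk]; rewrite E.
- have [->|_] := eqVneq n k.
    by rewrite (_ : (k == k + 1) = false) ?addr0 ?vabs1//; lia.
  by rewrite add0r; case: eqP; rewrite ?vabs0 ?vabs1.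
- by rewrite eqxx (_ : (k == k + 1) = false) ?addr0 ?vabs1//; lia.
- by rewrite eqxx (_ : (k + 1 == k) = false) ?add0r ?vabs1//; lia.
- have [-> ->] : (n == k) = false /\ (n == k + 1) = false by lia.
  by rewrite addr0 vabs0.
- have [-> ->] : (n == k) = false /\ (n == k + 1) = false by lia.
  by rewrite addr0 vabs0.
Qed.

Lemma shift_pencil_seq (lambda mu : K) (z : c0 v) :
  shift_pencil v lambda mu z = pencil_seq lambda mu z :> (int -> K).
Proof. by []. Qed.

Lemma edges_iter_pencil (lambda mu : K) (x : c0 v) r m M : v lambda != v mu ->
  edges x r m M ->
  forall p : nat, exists r' d, edges (iter p (shift_pencil v lambda mu) x)
    r' (m - d) (M - d).
Proof.
move=> lm xe; elim=> [|p [r' [d pe]]]; first by exists r, 0; rewrite !subr0.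
move: lm; rewrite neq_lt => /orP[lm|lm].
- exists (v mu * r'), (d + 1); rewrite iterS shift_pencil_seq !opprD !addrA.
  exact: edges_pencil_lt lm pe.
- exists (v lambda * r'), d; rewrite iterS shift_pencil_seq.
  exact: edges_pencil_gt lm pe.
Qed.

Lemma edges_dense (D : set (c0 v)) (y : c0 v) r m M :
  dense D -> edges y r m M -> exists2 w, D w & edges w r m M.
Proof.
move=> dD ye; have r0 := edges_gt0 ye.
have [||w [yw Dw]] := dD (ball y r)^°.
- by exists y; exact: nbhsx_ballx.
- exact: open_interior.
exists w => //; apply: edges_perturb ye _ => n.
have /interior_subset : (ball y r)^° w by [].
rewrite ballEmdist/= mdist_c0E; apply: le_lt_trans.
exact: (vabs_le_c0_norm (y - w) n).
Qed.

(** Each step of [T] translates both ends equally, and a scalar moves neither. *)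
Lemma orbit_width (lambda mu : K) (x : c0 v) (a : K) (p : nat) r m M r' m' M' :
  v lambda != v mu -> edges x r m M ->
  edges (a *: iter p (shift_pencil v lambda mu) x) r' m' M' -> M' - m' = M - m.
Proof.
move=> lm xe ae.
have a0 : a != 0 by have := edges_neq0 ae; rewrite scaler_eq0 => /norP[].
have [s [d /(edges_scale a0) se]] := edges_iter_pencil lm xe p.
have [_ -> ->] := edges_uniq ae se; lia.
Qed.

(** A nonzero vector has [m <= M], and one step of [T] moves [m] strictly to the
    left while fixing [M].  When both coefficients vanish the range contains no
    vector with edges. *)
Lemma range_width (lambda mu : K) (z : c0 v) r m M :
  v lambda = v mu -> edges (shift_pencil v lambda mu z) r m M -> m < M.
Proof.
move=> lm Te; have Tz0 := edges_neq0 Te.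
have mu0 : 0 < v mu.
  rewrite lt_def vabs_ge0 andbT; apply: contra Tz0 => /eqP mu0.
  have -> : lambda = 0 by apply/(vabs_eq0 v); rewrite lm.
  by move/vabs_eq0: mu0 => ->; rewrite shift_pencilE !scale0r addr0.
have z0 : z != 0 by apply: contra Tz0 => /eqP ->; rewrite linear0.
have [s [m' [M' ze]]] := edges_exist z0.
rewrite shift_pencil_seq in Te.
have [_ -> ->] := edges_uniq Te (edges_pencil_eq lm mu0 ze).
have := edges_leq ze; lia.
Qed.

End Edges.

Theorem theorem5p1 (R : realType) (K : fieldType) (v : nonarch_valuation R K)
    (K_nontrivial : nontrivial_valuation v)
    (K_complete : complete_space (valued v))
    (K_separable : separable_space (valued v))
    (lambda mu : K) :
  ~ supercyclic (shift_pencil v lambda mu).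
Proof.
move=> [x xd]; have [lm|lm] := eqVneq (v lambda) (v mu).
- (* The width 0 of [e_k] rules out the range of [T], so [x] itself is a multiple
     of [e_k] up to smaller terms, for every [k]. *)
  have first_x k : exists r, edges v x r k k.
    have [_ [a [n ->]] ae] := edges_dense xd (edges_delta v k).
    case: n ae => [|n] ae.
      have a0 : a != 0 by have := edges_neq0 ae; rewrite scaler_eq0 => /norP[].
      have aV0 : a^-1 != 0 by rewrite invr_eq0.
      exists (v a^-1 * 1); have := edges_scale aV0 ae.
      by congr (edges v _ _ _ _); apply/funext => i; exact: mulKf.
    by move: ae; rewrite iterS -linearZ => /(range_width lm); rewrite ltxx.
  have [[r e0] [s e1]] := (first_x 0, first_x 1).
  by have [] := edges_uniq e0 e1.
- have [_ [a [n ->]] ae] := edges_dense xd (edges_delta v 0).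
  have [_ [b [p ->]] be] := edges_dense xd (edges_deltaD v 0).
  have x0 : x != 0.
    apply: contra (edges_neq0 ae) => /eqP ->.
    suff -> : iter n (shift_pencil v lambda mu) 0 = 0 by rewrite scaler0.
    by elim: n {ae} => // n IHn; rewrite iterS IHn linear0.
  have [r [m [M xe]]] := edges_exist x0.
  by have := orbit_width lm xe ae; have := orbit_width lm xe be; lia.
Qed.
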